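(* For every integer $n\geq 0$, \[ B_n \setminus\{0\} = \coprod_{j=0}^{n} (1+i)^j D_{n-j}, \] where the union is disjoint and $(1+i)^j D = \{(1+i)^j d : d\in D\}$.
   Context: For $n \geq 0$, $B_n = \left\{ \sum_{j=0}^n v_j (1+i)^j : v_j \in \{0,\pm 1,\pm i\}\right\} \subset \mathbb{Z}[i]$. For $n\geq 0$ define $w_n = 2^{k+1}+2^k$ if $n=2k$ and $w_n = 2^{k+2}$ if $n=2k+1$. For $n\geq 0$ define \[ D_n = \{ x+yi \in \mathbb{Z}[i] : 2 \nmid (x+y);\ |x|,|y| \leq w_n - 2;\ |x|+|y| \leq w_{n+1}-3 \}. \] *)

(* Defs.v *)
From mathcomp Require Import all_boot all_order all_algebra all_field.
From mathcomp Require Import classical_sets.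
Set Implicit Arguments.
Unset Strict Implicit.
Unset Printing Implicit Defensive.
Import Order.TTheory GRing.Theory Num.Theory.
Local Open Scope classical_set_scope.
Local Open Scope ring_scope.

(* Z[i] is taken as the set of the x + y i with x, y : int inside the algebraic
   complex numbers. *)
Definition gauss (x y : int) : algC := x%:~R + y%:~R * 'i.

Definition digits : set algC := [set 0; 1; - 1; 'i; - 'i].

Definition B (n : nat) : set algC :=
  [set z | exists v : 'I_n.+1 -> algC,
     (forall j, digits (v j)) /\ z = \sum_(j < n.+1) v j * (1 + 'i) ^+ j].

Definition w (n : nat) : nat :=
  let k := n./2 in
  if odd n then (2 ^ (k + 2))%N else (2 ^ (k + 1) + 2 ^ k)%N.

Definition D (n : nat) : set algC :=
  [set z | exists x y : int,
     [/\ z = gauss x y,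
         ~~ (2 %| x + y)%Z,
         `|x| <= (w n)%:Z - 2,
         `|y| <= (w n)%:Z - 2
       & `|x| + `|y| <= (w n.+1)%:Z - 3]].

(* Main.v *)
Require Import Defs.
From mathcomp Require Import all_boot all_order all_algebra all_field.
From mathcomp Require Import classical_sets.
From mathcomp Require Import zify ring.
Import Order.TTheory GRing.Theory Num.Theory.
Local Open Scope classical_set_scope.
Local Open Scope ring_scope.

(** Multiplication by 1+i sends (x,y) to (x-y,x+y), so it exchanges, up to a
    factor 2, the sup norm and the l1 norm.  As w_(n+2) = 2 w_n, the octagon
    |x|,|y| <= w_n - 2, |x|+|y| <= w_(n+1) - 3 is mapped by b |-> u + (1+i)b,
    u a digit, into the next octagon; hence B_n lies in the n-th octagon.  An
    odd element of B_n is therefore in D_n, while an even one has lowest digit 0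
    and so is 1+i times an element of B_(n-1).  Conversely, from an odd x+yi in
    D_(n+1) one can subtract a unit so as to make both coordinates odd; since
    w_(n+1) is even, the result still has sup norm at most w_(n+1) - 3 and l1
    norm at most w_(n+2) - 4, so its quotient by 1+i lies in D_n.  Disjointness
    holds because elements of D are not divisible by 1+i. *)

Lemma wSS n : w n.+2 = (2 * w n)%N.
Proof. by rewrite /w /= negbK !addSn !expnS; case: ifP => _; lia. Qed.

Lemma w_even n : ~~ odd (w n.+1).
Proof. by elim/ltn_ind: n => -[|[|n]] IH //; rewrite wSS oddM. Qed.

Lemma w_gap n : (w n < w n.+1)%N.
Proof. by elim/ltn_ind: n => -[|[|n]] IH //; rewrite !wSS; have := IH n; lia. Qed.

Lemma w_ge3 n : (3 <= w n)%N.
Proof. by elim: n => // n IH; apply: leq_trans IH (ltnW (w_gap n)). Qed.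

Definition octagon (n : nat) (x y : int) : Prop :=
  [/\ `|x| <= (w n)%:Z - 2, `|y| <= (w n)%:Z - 2
    & `|x| + `|y| <= (w n.+1)%:Z - 3].

Lemma gauss_inj x y x' y' : gauss x y = gauss x' y' -> x = x' /\ y = y'.
Proof.
have re a b : 'Re (gauss a b) = a%:~R.
  by rewrite /gauss mulrC Re_rect ?Rreal_int ?intr_int // ?realz.
have im a b : 'Im (gauss a b) = b%:~R.
  by rewrite /gauss mulrC Im_rect ?Rreal_int ?intr_int // ?realz.
move=> e; split; apply: (@intr_inj algC); first by rewrite -(re x y) e re.
by rewrite -(im x y) e im.
Qed.

Lemma gauss0 : gauss 0 0 = 0.
Proof. by rewrite /gauss mul0r addr0. Qed.

Lemma gaussD x y x' y' : gauss x y + gauss x' y' = gauss (x + x') (y + y').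
Proof. by rewrite /gauss !intrD; ring. Qed.

Lemma mul_gauss x y : (1 + 'i) * gauss x y = gauss (x - y) (x + y).
Proof.
rewrite /gauss intrB intrD.
have -> : (1 + 'i) * (x%:~R + y%:~R * 'i) =
  x%:~R + (x%:~R + y%:~R) * 'i + y%:~R * 'i ^+ 2 :> algC by ring.
by rewrite sqrCi; ring.
Qed.

Lemma gauss_even x y : (2 %| x + y)%Z ->
  exists a b, [/\ gauss x y = (1 + 'i) * gauss a b, x = a - b & y = a + b].
Proof.
(* The quotient of x + yi by 1 + i is (x+y)/2 + ((y-x)/2)i, and [q] is (x+y)/2. *)
move=> /dvdzP[q hq]; exists q, (y - q).
have ex : x = q - (y - q) by lia.
have ey : y = q + (y - q) by lia.
by rewrite mul_gauss -ex -ey.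
Qed.

Lemma onei_neq0 : 1 + 'i != 0 :> algC.
Proof.
apply/eqP => h; have : gauss 1 1 = gauss 0 0 by rewrite gauss0 -h /gauss mul1r.
by case/gauss_inj.
Qed.

Lemma digitsP z :
  digits z <-> exists a b : int, z = gauss a b /\ `|a| + `|b| <= 1.
Proof.
split.
  case=> [[[[]|]|]|] /= ->.
  - by exists 0, 0; rewrite gauss0.
  - by exists 1, 0; rewrite /gauss mul0r addr0.
  - by exists (-1), 0; rewrite /gauss mul0r addr0 intrN.
  - by exists 0, 1; rewrite /gauss add0r mul1r.
  - by exists 0, (-1); rewrite /gauss add0r intrN mulN1r.
move=> [a [b [-> hab]]].
have : [\/ a = 0 /\ b = 0, a = 1 /\ b = 0, a = -1 /\ b = 0
     | a = 0 /\ b = 1] \/ a = 0 /\ b = -1.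
  case: (eqVneq a 0) => ha; case: (eqVneq b 0) => hb; [| | |lia].
  - by left; apply: Or41.
  - have [|] : b = 1 \/ b = -1 by lia.
      by left; apply: Or44.
    by right.
  - have [|] : a = 1 \/ a = -1 by lia.
      by left; apply: Or42.
    by left; apply: Or43.
rewrite /gauss /digits /=; case=> [[]|] [-> ->];
  rewrite ?intrN ?mul0r ?mulN1r ?mul1r ?addr0 ?add0r; tauto.
Qed.

Lemma B0P z : B 0 z <-> digits z.
Proof.
split=> [[v [hv ->]]|hz]; first by rewrite big_ord1 mulr1.
by exists (fun=> z); rewrite big_ord1 mulr1.
Qed.

Lemma BSP n z :
  B n.+1 z <-> exists u b, [/\ digits u, B n b & z = u + (1 + 'i) * b].
Proof.
split=> [[v [hv ->]]|[u [b [hu [v [hv ->]] ->]]]].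
  exists (v ord0), (\sum_(j < n.+1) v (lift ord0 j) * (1 + 'i) ^+ j).
  split=> //; first by exists (fun j => v (lift ord0 j)).
  rewrite big_ord_recl mulr1 mulr_sumr; congr (_ + _).
  by apply: eq_bigr => j _; rewrite exprS; ring.
(* [unlift ord0 j] is [None] only at [ord0], so the default [u] becomes the lowest digit and the
   digits [v] move up by one. *)
exists (fun j => oapp v u (unlift ord0 j)); split.
  by move=> j; case: unlift.
rewrite [RHS]big_ord_recl unlift_none mulr1 mulr_sumr; congr (_ + _).
by apply: eq_bigr => j _; rewrite liftK /= exprS; ring.
Qed.

Lemma B_mul_onei n z : B n z -> B n.+1 ((1 + 'i) * z).
Proof.
move=> hz; apply/BSP; exists 0, z; rewrite add0r; split=> //.
by apply/digitsP; exists 0, 0; rewrite gauss0.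
Qed.

(** Both |x-y| and |x+y| are at most |x|+|y| <= w_(n+1) - 3, while |x-y| + |x+y| = 2 max(|x|,|y|) <=
    w_(n+2) - 4; the digit adds at most 1 to each bound. *)
Lemma octagon_digit_onei {n x y a b} : octagon n x y -> `|a| + `|b| <= 1 ->
  octagon n.+1 (a + (x - y)) (b + (x + y)).
Proof. by rewrite /octagon wSS => -[h1 h2 h3] hab; split; lia. Qed.

Lemma B_octagon {n z} : B n z -> exists x y, z = gauss x y /\ octagon n x y.
Proof.
elim: n z => [|n IH] z.
  move=> /B0P/digitsP[a [b [-> hab]]]; exists a, b; split=> //.
  by rewrite /octagon; have -> : w 0 = 3%N by []; have -> : w 1 = 4%N by []; split; lia.
move=> /BSP[u [b [/digitsP[a1 [a2 [-> ha]]] /IH[x [y [-> hxy]]] ->]]].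
rewrite mul_gauss gaussD.
by do 2 eexists; split; [reflexivity|exact: octagon_digit_onei].
Qed.

Lemma D_step n z :
  D n.+1 z -> exists u d, [/\ digits u, D n d & z = u + (1 + 'i) * d].
Proof.
move=> [x [y [-> hodd hx hy hxy]]].
have [a [b [hab hpar hmx hmy hs]]] : exists a b : int,
  [/\ `|a| + `|b| <= 1, ~~ (2 %| x - a)%Z && ~~ (2 %| y - b)%Z,
      `|x - a| <= (w n.+1)%:Z - 3, `|y - b| <= (w n.+1)%:Z - 3
    & `|x - a| + `|y - b| <= (w n.+2)%:Z - 4].
  have := w_even n; have := w_even n.+1; have := w_gap n.+1; have := w_ge3 n.+1.
  move: (w n.+1) (w n.+2) hx hy hxy => p q hx hy hxy p3 pq oq op.
  (* Exactly one coordinate is even; it is moved by 1 towards 0, or to 1 or -1 if it vanishes. The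
     odd one is at most w_(n+1) - 3 in absolute value, as w_(n+1) is even. If the even one is 0, the
     sum is at most w_(n+1) - 2 <= w_(n+2) - 4, since two distinct even numbers differ by at least
     2. *)
  case: (boolP (2 %| y)%Z) => ey.
    by exists 0, (if 0 <= y then 1 else -1); case: ifP => sy; split; lia.
  by exists (if 0 <= x then 1 else -1), 0; case: ifP => sx; split; lia.
have [|c [d [ecd ec ed]]] := @gauss_even (x - a) (y - b); first by lia.
exists (gauss a b), (gauss c d); split.
- by apply/digitsP; exists a, b.
(* The quotient is odd because [c + d] equals the odd number [y - b]. *)
- exists c, d; move: hs; rewrite wSS => hs; split=> //; lia.
- by rewrite -ecd gaussD; congr gauss; ring.
Qed.

Lemma D_sub_B n : D n `<=` B n.
Proof.
elim: n => [|n IH] z.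
  by move=> [x [y [-> _ _ _ h]]]; apply/B0P/digitsP; exists x, y; split; last exact: h.
by move=> /D_step[u [d [hu /IH hd ->]]]; apply/BSP; exists u, d.
Qed.

Lemma gauss_exp_onei m x y :
  exists a b, (1 + 'i) ^+ m * gauss x y = gauss a b.
Proof.
elim: m => [|m [a [b e]]]; first by exists x, y; rewrite mul1r.
by exists (a - b), (a + b); rewrite exprS -mulrA e mul_gauss.
Qed.

(** A Gaussian multiple of 1 + i has coordinates a - b and a + b, whose sum 2a is even. *)
Lemma D_not_onei_mul {n k d z} m :
  D n d -> D k z -> d <> (1 + 'i) ^+ m.+1 * z.
Proof.
move=> [x [y [-> hodd _ _ _]]] [x' [y' [-> _ _ _ _]]].
have [a [b e]] := gauss_exp_onei m x' y'.
by rewrite exprS -mulrA e mul_gauss => /gauss_inj[ex ey]; lia.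
Qed.

Lemma D_neq0 {n d} : D n d -> d != 0.
Proof.
move=> [x [y [-> hodd _ _ _]]]; apply/eqP.
by rewrite -gauss0 => /gauss_inj[ex ey]; lia.
Qed.

Lemma exp_onei_D_inj {n k d z i j} : (i <= j)%N -> D n d -> D k z ->
  (1 + 'i) ^+ i * d = (1 + 'i) ^+ j * z -> i = j.
Proof.
move=> ij hd hz; rewrite -(subnK ij) addnC exprD -mulrA.
move/(mulfI (expf_neq0 i onei_neq0)).
case: (j - i)%N => [|m]; first by rewrite addn0.
by move/(D_not_onei_mul m hd hz).
Qed.

Lemma B_sub_bigcup n z : B n z -> z != 0 ->
  exists j d, [/\ (j <= n)%N, D (n - j) d & z = (1 + 'i) ^+ j * d].
Proof.
elim: n z => [|n IH] z hz z0; have [x [y [ez [h1 h2 h3]]]] := B_octagon hz.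
  exists 0%N, z; rewrite mul1r; split=> //; exists x, y; split=> //.
  (* The bound |x| + |y| <= w_1 - 3 = 1 leaves 0 as the only even point. *)
  apply: contraNN z0 => even_xy; move: h3; have -> : w 1 = 4%N by [].
  move=> h3; have [x0 y0] : x = 0 /\ y = 0 by lia.
  by rewrite ez x0 y0 gauss0.
case: (boolP (2 %| x + y)%Z) => [even_xy|odd_xy]; last first.
  by exists 0%N, z; rewrite mul1r subn0; split=> //; exists x, y.
move/BSP: hz => [u [b [/digitsP[a1 [a2 [-> ha]]] hb]]].
have [x' [y' [eb _]]] := B_octagon hb.
rewrite ez eb mul_gauss gaussD => /gauss_inj[ex ey].
(* Since x + y = a1 + a2 + 2x' is even, so is a1 + a2, and |a1| + |a2| <= 1 then forces the digit to
   be 0. *)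
have [e1 e2] : a1 = 0 /\ a2 = 0 by lia.
have ezb : z = (1 + 'i) * b by rewrite ez eb mul_gauss ex ey e1 e2 !add0r.
have b0 : b != 0 by apply: contraNneq z0 => b0; rewrite ezb b0 mulr0.
have [j [d [jn hd ebd]]] := IH _ hb b0.
by exists j.+1, d; rewrite subSS exprS -mulrA -ebd -ezb ez.
Qed.

Lemma exp_onei_D_sub_B n j d : (j <= n)%N -> D (n - j) d ->
  B n ((1 + 'i) ^+ j * d).
Proof.
elim: j n => [|j IH] [|n] // jn; rewrite ?subn0 ?mul1r ?subSS.
1,2: exact: D_sub_B.
by move=> /(IH _ jn) h; rewrite exprS -mulrA; apply: B_mul_onei.
Qed.

Theorem theorem2p7 (n : nat) :
  B n `\ 0 = \bigcup_(j in `I_n.+1) [set (1 + 'i) ^+ j * d | d in D (n - j)]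
  /\ trivIset `I_n.+1 (fun j : nat => [set (1 + 'i) ^+ j * d | d in D (n - j)]).
Proof.
split.
  apply/seteqP; split=> z.
    move=> [hz /eqP z0]; have [j [d [jn hd ->]]] := B_sub_bigcup _ _ hz z0.
    by exists j => //; exists d.
  move=> [j /= jn [d hd <-]]; split; first exact: exp_onei_D_sub_B.
  by apply/eqP; rewrite mulf_neq0 ?expf_neq0 ?onei_neq0 ?(D_neq0 hd).
move=> i j _ _ [z [[d hd <-] [d' hd' e]]].
case: (leqP i j) => [ij|/ltnW ji].
  exact: exp_onei_D_inj ij hd hd' (esym e).
exact/esym/(exp_onei_D_inj ji hd' hd e).
Qed.
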